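(* The single-sample mechanism $\mathbb M$ described in the context satisfies dominant strategy incentive compatibility (DSIC), individual rationality (IR), and weak budget balance (WBB).
   Context: Market model. Buyers $N_0=\{1,\dots,n\}$, sellers $M=\{1,\dots,m\}$, bipartite edge set $E\subseteq N_0\times M$; edge $(i,j)$ written $ij$; $E_S$ is the set of edges incident to participants in $S$ ($E_i=E_{\{i\}}$); $w(F)=\sum_{e\in F}w_e$. Each seller $j$ has a monotone submodular $f_j:2^{E_j}\to\mathbb R_+$ with $f_j(\emptyset)=0$, polymatroid $P_j=\{y\in\mathbb R^{E_j}_+:y(F)\le f_j(F)\ \forall F\}$ ($f_j(E_j)$ = her total amount of a homogeneous divisible good). Buyer $i$ has private per-unit valuation $v_i>0$ and budget $B_i\ge0$; seller $j$ private per-unit valuation $\rho_j>0$. An allocation is $(w,p,r)$, $x_i=w(E_i)$ for buyers and $x_j=f_j(E_j)-w(E_j)$ for sellers. Utilities: buyer $v_ix_i-p_i$ if $p_i\le B_i$, $-\infty$ otherwise; seller $r_j-\rho_j(f_j(E_j)-x_j)$. DSIC: for every input, each participant maximizes her utility by bidding her true valuation, whatever the others bid. IR: truthful bidding yields nonnegative utility. WBB: $\sum_ip_i\ge\sum_jr_j$. Single-sample setting: each $\rho_j\sim G_j$ independently, and the mechanism additionally receives a sample $\rho^s_j\sim G_j$ for each seller. Polyhedral Clinching Auction ${\rm PCA}$ with step $\varepsilon>0$ on a market with sellers $M'$ and seller bids $\sigma_j$: for each $j\in M'$ add a virtual buyer $n+j$ adjacent only to $j$ with bid $\sigma_j$ and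 budget $\infty$; extend $f_j$ by $f_j(F)=f_j(E_j)$ if $(n+j)j\in F$; let $N$ be all (real and virtual) buyers, $P'=\{w\ge0: w|_{E_j}\in P_j\ \forall j\in M'\}$ (with extended $P_j$). Bids $v'_i$ (for virtual $n+j$: $\sigma_j$) are assumed positive multiples of $\varepsilon$. State: $w$, $p$, $r$, clocks $c_i$, demands $d_i$; initially $w=0,p=0,r=0,c_i=0,d_i=\infty$, $l$ = first buyer. With $P_{w,d}=\{y\ge0:w+y\in P',\ y(E_k)\le d_k\ \forall k\}$ and $P^i_{w,d}(\xi)=\{u\in\mathbb R^{N\setminus\{i\}}_+:\exists y\in P_{w,d},y|_{E_i}=\xi,y(E_k)=u_k\ \forall k\ne i\}$: while some $d_i\ne0$: (1) for each buyer $i$ in turn choose a maximal $\xi_i\in\mathbb R^{E_i}_+$ with $P^i_{w,d}(\xi_i)=P^i_{w,d}(0)$, set $p_i\leftarrow p_i+c_i\xi_i(E_i)$, $w\leftarrow w+\xi_i$, reset every $d_k=(B_k-p_k)/c_k$ if $c_k<v'_k$ else $0$ ($\infty$ while $c_k=0$); then $r_j\leftarrow r_j+\sum_{ij\in E_j}c_i\xi_{ij}$; (2) $c_l\leftarrow c_l+\varepsilon$, update $d_l$ likewise; (3) advance $l$ cyclically. Output: $w$, $p$ restricted to real buyers and revenues $r_j-p_{n+j}$. Mechanism $\mathbb M$ (given buyers' bids $v'$, budgets $B$, sellers' bids $\rho'$, samples $\rho^s$): let $\tilde M=\{j\in M:\rho^s_j\ge\rho'_j\}$ and $\tilde E=\{ij\in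 E: j\in\tilde M\}$; run PCA on the market with sellers $\tilde M$, edges $\tilde E$, buyers' bids $v'$, budgets $B$ and seller bids $\sigma_j=\rho^s_j$, obtaining $(w,p,r)$; output $w^{\rm f}_{ij}=w_{ij}$ for $ij\in\tilde E$ and $0$ otherwise, $p^{\rm f}_i=p_i$, and $r^{\rm f}_j=\rho^s_j\,w(\tilde E_j)$ for $j\in\tilde M$ (where $\tilde E_j$ are $j$'s edges to real buyers) and $r^{\rm f}_j=0$ otherwise. *)

(* Defs.v *)
From HB Require Import structures.
From mathcomp Require Import all_boot all_order all_algebra.
From mathcomp Require Import reals constructive_ereal.
Set Implicit Arguments. Unset Strict Implicit. Unset Printing Implicit Defensive.
Import Order.TTheory GRing.Theory Num.Theory.
Local Open Scope ring_scope.

(* Generic Polyhedral Clinching Auction on a market with buyer type N,        *)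
(* seller type M, edge set E, rank functions g (the polymatroids P_j),        *)
(* participating buyers Nact, bids, budgets (None = infinite budget), step    *)
(* eps and an oracle [chooser] which, given (w, d, i), returns the vector     *)
(* xi_i to be clinched (assumed maximal, see [maximal_clinch] below).         *)
Section PCA.
Variable R : realType.
Variables N M : finType.
Variable E : {set N * M}.
Variable g : M -> {set N * M} -> R.
Variable Nact : {set N}.

Definition Eb (k : N) : {set N * M} := [set e in E | e.1 == k].
Definition Es (j : M) : {set N * M} := [set e in E | e.2 == j].

Definition vsum (y : N * M -> R) (F : {set N * M}) : R := \sum_(e in F) y e.

Definition inP' (w : N * M -> R) : Prop :=
  [/\ forall e, 0 <= w e,
      forall e, e \notin E -> w e = 0 &
      forall (j : M) (F : {set N * M}), F \subset Es j -> vsum w F <= g j F].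

(* y(E_k) <= d_k, with d_k = None meaning d_k = infinity *)
Definition demand_ok (d : N -> option R) (k : N) (x : R) : Prop :=
  match d k with Some dk => x <= dk | None => True end.

Definition inPwd (w : N * M -> R) (d : N -> option R) (y : N * M -> R) : Prop :=
  [/\ forall e, 0 <= y e,
      forall e, e \notin E -> y e = 0,
      inP' (fun e => w e + y e) &
      forall k, k \in Nact -> demand_ok d k (vsum y (Eb k))].

(* u \in P^i_{w,d}(xi); u is a vector indexed by buyers, only the
   coordinates k \in Nact, k != i are meaningful (the others are free). *)
Definition Pi (w : N * M -> R) (d : N -> option R) (i : N)
    (xi : N * M -> R) (u : N -> R) : Prop :=
  exists y, [/\ inPwd w d y,
               forall e, e \in Eb i -> y e = xi e &
               forall k, k \in Nact -> k != i -> vsum y (Eb k) = u k].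

Definition admissible_clinch w d i (xi : N * M -> R) : Prop :=
  [/\ forall e, 0 <= xi e,
      forall e, e \notin Eb i -> xi e = 0 &
      forall u, Pi w d i xi u <-> Pi w d i (fun _ => 0) u].

Definition maximal_clinch w d i (xi : N * M -> R) : Prop :=
  admissible_clinch w d i xi /\
  forall xi', admissible_clinch w d i xi' -> (forall e, xi e <= xi' e) -> xi' = xi.

Variable bid : N -> R.
Variable B : N -> option R.
Variable eps : R.
Variable chooser : (N * M -> R) -> (N -> option R) -> N -> (N * M -> R).

Record state := St {
  sw : N * M -> R;       (* allocation w *)
  sp : N -> R;           (* payments p *)
  sr : M -> R;           (* revenues r *)
  sc : N -> R;           (* clocks c *)
  sd : N -> option R;    (* demands d (None = infinity) *)
  st : nat               (* number of completed rounds; l = (st mod #|Nact|)-th buyer *)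
}.

Definition demand_of (p c : N -> R) (k : N) : option R :=
  if c k == 0 then None
  else if c k < bid k then
         (match B k with Some b => Some ((b - p k) / c k) | None => None end)
       else Some 0.

Definition clinch_one (s : state) (i : N) : state :=
  let xi := chooser (sw s) (sd s) i in
  let p' := fun k => if k == i then sp s k + sc s i * vsum xi (Eb i) else sp s k in
  let w' := fun e => sw s e + xi e in
  let r' := fun j => sr s j + \sum_(e in Es j) sc s e.1 * xi e in
  St w' p' r' (sc s) (demand_of p' (sc s)) (st s).

Definition clinch_all (s : state) : state :=
  foldl clinch_one s (enum Nact).

Definition cur_buyer (t : nat) : option N :=
  onth (enum Nact) (t %% #|Nact|).

Definition raise (s : state) : state :=
  match cur_buyer (st s) with
  | Some l =>
      let c' := fun k => if k == l then sc s k + eps else sc s k in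
      St (sw s) (sp s) (sr s) c'
         (fun k => if k == l then demand_of (sp s) c' k else sd s k) (st s).+1
  | None => St (sw s) (sp s) (sr s) (sc s) (sd s) (st s).+1
  end.

Definition pca_round (s : state) : state := raise (clinch_all s).

Definition pca_init : state :=
  St (fun _ => 0) (fun _ => 0) (fun _ => 0) (fun _ => 0) (fun _ => None) 0.

Definition halted (s : state) : Prop := forall k, k \in Nact -> sd s k = Some 0.

Definition pca_final (s : state) : Prop :=
  exists K : nat,
    [/\ forall K', (K' < K)%N -> ~ halted (iter K' pca_round pca_init),
        halted (iter K pca_round pca_init) &
        s = iter K pca_round pca_init].

End PCA.

(* augmented buyers: inl i = real buyer i, inr j = virtual buyer n+j *)
Definition AB (n m : nat) : finType := ('I_n + 'I_m)%type.

Definition chooser_t (R : realType) (n m : nat) : Type :=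
  {set AB n m * 'I_m} -> {set AB n m} -> ('I_m -> {set AB n m * 'I_m} -> R) ->
  (AB n m * 'I_m -> R) -> (AB n m -> option R) -> AB n m -> (AB n m * 'I_m -> R).

Definition chooser_spec (R : realType) (n m : nat) (ch : chooser_t R n m) : Prop :=
  forall (Ea : {set AB n m * 'I_m}) (Na : {set AB n m})
         (ga : 'I_m -> {set AB n m * 'I_m} -> R) w d i,
    (exists xi, maximal_clinch Ea ga Na w d i xi) ->
    maximal_clinch Ea ga Na w d i (ch Ea Na ga w d i).

Record outcome (R : realType) (n m : nat) := Outcome {
  ow : 'I_n * 'I_m -> R;
  op : 'I_n -> R;
  or : 'I_m -> R }.

Section Mech.
Variable R : realType.
Variables n m : nat.
Variable E : {set 'I_n * 'I_m}.
Variable f : 'I_m -> {set 'I_n * 'I_m} -> R.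
Variable eps : R.
Variable ch : chooser_t R n m.

Definition Eseller (j : 'I_m) : {set 'I_n * 'I_m} := [set e in E | e.2 == j].
Definition Ebuyer (i : 'I_n) : {set 'I_n * 'I_m} := [set e in E | e.1 == i].

Definition polymatroid_rank (j : 'I_m) : Prop :=
  [/\ f j set0 = 0,
      forall F : {set 'I_n * 'I_m}, F \subset Eseller j -> 0 <= f j F,
      forall F G : {set 'I_n * 'I_m}, F \subset G -> G \subset Eseller j -> f j F <= f j G &
      forall F G : {set 'I_n * 'I_m}, F \subset Eseller j -> G \subset Eseller j ->
        f j (F :|: G) + f j (F :&: G) <= f j F + f j G].

Section Inputs.
Variables (v' : 'I_n -> R) (B : 'I_n -> R) (rho' rhos : 'I_m -> R).

Definition Mtil : {set 'I_m} := [set j | rho' j <= rhos j].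
Definition Etil : {set 'I_n * 'I_m} := [set e in E | e.2 \in Mtil].

Definition Eaug : {set AB n m * 'I_m} :=
  [set e : AB n m * 'I_m |
     match e.1 with
     | inl i => (i, e.2) \in Etil
     | inr j => (j == e.2) && (j \in Mtil)
     end].

Definition Naug : {set AB n m} :=
  [set a : AB n m | match a with inl _ => true | inr j => j \in Mtil end].

Definition gaug (j : 'I_m) (F : {set AB n m * 'I_m}) : R :=
  if (inr j, j) \in F then f j (Eseller j)
  else f j [set e : 'I_n * 'I_m | (inl e.1, e.2) \in F].

Definition bidaug (a : AB n m) : R :=
  match a with inl i => v' i | inr j => rhos j end.

Definition Baug (a : AB n m) : option R :=
  match a with inl i => Some (B i) | inr _ => None end.

Definition M_outcome (o : outcome R n m) : Prop :=
  exists s, @pca_final R (AB n m) _ Eaug Naug bidaug Baug eps (ch Eaug Naug gaug) s /\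
    o = Outcome
          (fun e => if e \in Etil then sw s (inl e.1, e.2) else 0)
          (fun i => sp s (inl i))
          (fun j => if j \in Mtil then
                      rhos j * \sum_(e in Etil | e.2 == j) sw s (inl e.1, e.2)
                    else 0).
End Inputs.

Definition xbuyer (o : outcome R n m) (i : 'I_n) : R := \sum_(e in Ebuyer i) ow o e.
Definition xseller (o : outcome R n m) (j : 'I_m) : R :=
  f j (Eseller j) - \sum_(e in Eseller j) ow o e.

Definition ubuyer (v Bi : R) (o : outcome R n m) (i : 'I_n) : \bar R :=
  if op o i <= Bi then (v * xbuyer o i - op o i)%:E else -oo%E.

Definition useller (rho : R) (o : outcome R n m) (j : 'I_m) : R :=
  or o j - rho * (f j (Eseller j) - xseller o j).

End Mech.

Definition eps_mult (R : realType) (eps x : R) : Prop := exists k : nat, x = k.+1%:R * eps.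

Definition upd (I : eqType) (T : Type) (h : I -> T) (i : I) (x : T) : I -> T :=
  fun k => if k == i then x else h k.

Definition valid_inputs (R : realType) (n m : nat) (eps : R)
    (v' B : 'I_n -> R) (rho' rhos : 'I_m -> R) : Prop :=
  [/\ forall i, eps_mult eps (v' i), forall i, 0 <= B i,
      forall j, 0 < rho' j & forall j, eps_mult eps (rhos j)].

(* Main.v *)
From mathcomp Require Import boolp classical_sets reals constructive_ereal.
From mathcomp Require Import interval_inference filter topology normedtype.
From HB Require Import structures.
From mathcomp Require Import all_boot all_order all_algebra.
Require Import Defs.
Set Implicit Arguments. Unset Strict Implicit. Unset Printing Implicit Defensive.
Import Order.TTheory GRing.Theory Num.Theory numFieldNormedType.Exports.
Local Open Scope ring_scope.

(* As long as [w] is feasible and the demands are nonnegative, the clinchable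
   vectors form a nonempty compact set, so a maximal one exists; applying
   [P^i(xi) = P^i(0)] to the zero vector shows that clinching it preserves
   feasibility and respects the demand of the buyer, hence her budget.  A buyer
   whose clock has reached her bid therefore clinches nothing, which gives
   individual rationality for buyers.  The clocks do not depend on the bids, so
   the loop stops, and two runs that differ in the bid of one buyer coincide
   until her clock reaches the smaller bid: this gives truthfulness.

   While the virtual buyer of seller [j] has infinite demand she can absorb all
   the good of [j], so real buyers clinch nothing from [j].  Real buyers precede
   virtual ones in the cyclic order, so their clocks are at least [rhos j] when
   they start to buy from [j], and weak budget balance follows.  A seller only
   decides whether she participates at the fixed price [rhos j]. *)

(** * Limits of bounded real sequences along an ultrafilter *)

Section UltraLimit.
Local Open Scope classical_set_scope.

(* [L] is the limit along an ultrafilter finer than [\oo]. *)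
Lemma bounded_limit_functional (R : realType) :
  exists L : (nat -> R) -> R,
    [/\ forall (I : finType) (F : {set I}) (a : I -> nat -> R),
          (forall i, exists b : R, forall k, `|a i k| <= b) ->
          L (fun k => \sum_(i in F) a i k) = \sum_(i in F) L (a i),
        forall (a : nat -> R) (b c : R), (forall k, `|a k| <= b) ->
          (forall k, a k <= c) -> L a <= c &
        forall (a : nat -> R) (b c : R), (forall k, `|a k| <= b) ->
          (forall k, c - k.+1%:R^-1 <= a k) -> c <= L a].
Proof.
have [U [UU ooU]] := @ultraFilterLemma nat \oo _.
have cvgU (a : nat -> R) (b : R) : (forall k, `|a k| <= b) -> cvg (a @ U).
  move=> ab.
  (* The image of [U] under [a] is again an ultrafilter and contains the compact segment from [-b]
     to [b], so it converges. *)
  have := @segment_compact R (- b) b.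
  rewrite compact_ultra => /(_ (a @ U) _ _)[].
  - split; first exact: fmap_proper_filter.
    move=> G PG aG; apply/seteqP; split => [A GA|]; last exact: aG.
    have [//|UA] := in_ultra_setVsetC (a @^-1` A) UU.
    have [x []//] : exists x, (A `&` ~` A) x.
    by apply: (@filter_ex _ G); apply: filterI => //; exact: aG.
  - apply: (@filterS _ U _ classical_sets.setT); last exact: filterT.
    move=> k _ /=.
    by rewrite in_itv /= -ler_norml.
  - by move=> l [_ /= al]; apply/cvg_ex; exists l.
exists (fun a => lim (a @ U)); split.
- move=> I F a ab.
  apply/cvg_lim; first exact: norm_hausdorff.
  rewrite -!big_enum /=; under eq_fun do rewrite -big_enum /=.
  elim: (enum F) => [|i r IH].
    by rewrite big_nil; under eq_fun do rewrite big_nil; exact: cvg_cst.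
  have -> : (fun k => \sum_(h <- i :: r) a h k) =
            a i \+ (fun k => \sum_(h <- r) a h k).
    by apply/funext => k; rewrite big_cons.
  by rewrite big_cons; apply: cvgD => //; have [b /cvgU] := ab i.
- by move=> a b c /cvgU aU ac; apply: limr_le => //; exact: nearW.
- move=> a b c /cvgU aU ac; apply/ler_addgt0Pr => e e0.
  rewrite -lerBlDr; apply: limr_ge => //.
  have := near_infty_natSinv_lt (PosNum e0).
  move=> /ooU; apply: filterS => k /= ke.
  by apply: le_trans (ac k); rewrite lerD2l lerN2 ltW.
Qed.
End UltraLimit.

(** * Feasible allocations and the existence of maximal clinches *)

Section Clinching.
Variables (R : realType) (N M : finType) (E : {set N * M}).
Variable g : M -> {set N * M} -> R.
Variable Nact : {set N}.
Implicit Types (w y xi : N * M -> R) (d : N -> option R) (i : N) (j : M).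
Implicit Types F : {set N * M}.

Lemma vsumD w y F : vsum (fun e => w e + y e) F = vsum w F + vsum y F.
Proof. exact: big_split. Qed.

Lemma vsum0 y F : (forall e, e \in F -> y e = 0) -> vsum y F = 0.
Proof. by move=> y0; apply: big1. Qed.

Lemma vsum_ge0 y F : (forall e, 0 <= y e) -> 0 <= vsum y F.
Proof. by move=> y0; apply: sumr_ge0. Qed.

Lemma ler_vsum w y F : (forall e, e \in F -> w e <= y e) -> vsum w F <= vsum y F.
Proof. exact: ler_sum. Qed.

Lemma eq_vsum w y F : (forall e, e \in F -> w e = y e) -> vsum w F = vsum y F.
Proof. exact: eq_bigr. Qed.

Lemma vsum_subset y (F G : {set N * M}) :
  (forall e, 0 <= y e) -> F \subset G -> vsum y F <= vsum y G.
Proof.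
move=> y0 FG; rewrite /vsum (big_setID F (A := G)) /= (setIidPr FG) lerDl.
exact: sumr_ge0.
Qed.

Lemma vsum_set1 y e : vsum y [set e] = y e.
Proof. exact: big_set1. Qed.

Lemma in_Eb k e : (e \in Eb E k) = (e \in E) && (e.1 == k).
Proof. by rewrite inE. Qed.

Lemma in_Es j e : (e \in Es E j) = (e \in E) && (e.2 == j).
Proof. by rewrite inE. Qed.

Lemma inP'_le w y : inP' E g w -> (forall e, 0 <= y e) ->
  (forall e, y e <= w e) -> inP' E g y.
Proof.
move=> [w0 wE wg] y0 yw; split=> // [e eE|j F Fj].
  by apply/eqP; rewrite eq_le y0 -(wE e eE) yw.
by apply: le_trans (wg j F Fj); apply: ler_vsum.
Qed.

(** The rank constraint of a single edge gives a bound uniform in [y], hence the boundedness needed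
    for limits. The absolute value also covers edges outside [E], where the sign of [g] is
    unknown. *)
Lemma inPwd_le1 w d y e : inP' E g w -> inPwd E g Nact w d y ->
  y e <= `|g e.2 [set e]|.
Proof.
move=> [w0 _ _] [y0 yE [_ _ wyg] _].
have [eE|/yE ->] := boolP (e \in E); last exact: normr_ge0.
have := wyg e.2 [set e]; rewrite vsum_set1 sub1set in_Es eE eqxx => /(_ isT) h.
by apply: le_trans (ler_norm _); apply: le_trans h; rewrite lerDr.
Qed.

Definition nonneg_demands d := forall k, k \in Nact -> demand_ok d k 0.

Lemma inPwd0 w d : inP' E g w -> nonneg_demands d -> inPwd E g Nact w d (fun=> 0).
Proof.
move=> wP d0; split=> //.
  by apply: (inP'_le wP) => e; rewrite addr0 //; case: wP.
by move=> k kN; rewrite vsum0 //; exact: d0.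
Qed.

Lemma Pi0 w d i : inP' E g w -> nonneg_demands d ->
  Pi E g Nact w d i (fun=> 0) (fun=> 0).
Proof.
move=> wP d0; exists (fun=> 0); split=> //; first exact: inPwd0.
by move=> k _ _; exact: vsum0.
Qed.

(** Erasing a witness on the edges of [i] keeps it feasible, since feasibility is inherited by
    smaller vectors, and does not change what the other buyers receive. Thus only the converse
    inclusion constrains [xi]. *)
Lemma Pi_sub0 w d i xi u : inP' E g w -> nonneg_demands d ->
  Pi E g Nact w d i xi u -> Pi E g Nact w d i (fun=> 0) u.
Proof.
move=> [w0 wE wg] d0 [y [[y0 yE wyP yd] yxi yu]].
pose z e := if e \in Eb E i then 0 else y e.
have z0 e : 0 <= z e by rewrite /z; case: ifP.
have zk k : k != i -> vsum z (Eb E k) = vsum y (Eb E k).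
  move=> ki; apply: eq_vsum => e; rewrite /z !in_Eb => /andP[-> /eqP->] /=.
  by rewrite (negPf ki).
exists z; split=> [|e|k kN ki]; last by rewrite zk // yu.
- split=> //.
  + by move=> e eE; rewrite /z yE // if_same.
  + apply: (inP'_le wyP) => e; first by rewrite addr_ge0.
    by rewrite lerD2l /z; case: ifP.
  + move=> k kN; have [ki|ki] := eqVneq k i; last by rewrite zk //; exact: yd.
    by rewrite vsum0 => [|e]; [exact: d0|rewrite ki /z => ->].
- by rewrite /z => ->.
Qed.

Lemma admissible_clinchP w d i xi : inP' E g w -> nonneg_demands d ->
  (forall e, 0 <= xi e) -> (forall e, e \notin Eb E i -> xi e = 0) ->
  (forall u, Pi E g Nact w d i (fun=> 0) u -> Pi E g Nact w d i xi u) ->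
  admissible_clinch E g Nact w d i xi.
Proof. by move=> wP d0 xi0 xiE h; split=> // u; split; [exact: Pi_sub0|exact: h]. Qed.

(** The zero vector of amounts lies in [P^i(0)], hence in [P^i(xi)]. Its witness agrees with [xi] on
    the edges of [i] and vanishes on those of every other buyer, so it is [xi] itself. *)
Lemma admissible_clinch_inPwd w d i xi :
  (forall e, e \in E -> e.1 \in Nact) ->
  inP' E g w -> nonneg_demands d ->
  admissible_clinch E g Nact w d i xi -> inPwd E g Nact w d xi.
Proof.
move=> EN wP d0 [xi0 xiE /(_ (fun=> 0))[_ /(_ (Pi0 _ wP d0))]].
case=> y [[y0 yE wyP yd] yxi yu].
suff -> : xi = y by [].
apply/funext => e; have [ei|ei] := boolP (e \in Eb E i); first by rewrite yxi.
rewrite xiE //; have [eE|/yE //] := boolP (e \in E).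
move: ei; rewrite in_Eb eE /= => ei.
have := yu _ (EN _ eE) ei => /eqP; rewrite psumr_eq0 // => /allP/(_ e).
by rewrite mem_index_enum in_Eb eE eqxx => /(_ isT)/= /eqP.
Qed.

(** Among admissible vectors, take a sequence whose totals on the edges of [i] approach their
    supremum. Its limit under [L] is admissible and attains the supremum; an admissible vector above
    the limit has the same total, hence equals it. *)
Lemma exists_maximal_clinch w d i :
  (forall e, e \in E -> e.1 \in Nact) ->
  inP' E g w -> nonneg_demands d ->
  exists xi, maximal_clinch E g Nact w d i xi.
Proof.
move=> EN wP d0; pose A xi := admissible_clinch E g Nact w d i xi.
pose b e : R := `|g e.2 [set e]|.
have A0 : A (fun=> 0) by [].
have Ab xi e : A xi -> `|xi e| <= b e.
  move=> Axi; rewrite ger0_norm; last by case: Axi.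
  exact/(inPwd_le1 _ wP)/admissible_clinch_inPwd/Axi.
pose S : set R := fun x => exists2 xi, A xi & x = vsum xi (Eb E i).
have Sub : has_ubound S.
  exists (vsum b (Eb E i)) => _ [xi Axi ->]; apply: ler_vsum => e _.
  exact: le_trans (ler_norm _) (Ab _ _ Axi).
have hS : has_sup S by split=> //; exists (vsum (fun=> 0) (Eb E i)), (fun=> 0).
have /choice[x Hx] (k : nat) :
    exists xi, A xi /\ sup S - k.+1%:R^-1 <= vsum xi (Eb E i).
  have k0 : 0 < k.+1%:R^-1 :> R by rewrite invr_gt0 ltr0n.
  by have [_ [xi Axi ->] /ltW] := sup_adherent k0 hS; exists xi.
have [L [Lsum Lle Lge]] := bounded_limit_functional R.
have Lge' (a : nat -> R) (c c' : R) :
    (forall k, `|a k| <= c) -> (forall k, c' <= a k) -> c' <= L a.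
  move=> ac a0; apply: (Lge _ c) => // k; apply: le_trans (a0 k).
  by rewrite gerBl invr_ge0.
have Lcst (a : nat -> R) (c c' : R) :
    (forall k, `|a k| <= c) -> (forall k, a k = c') -> L a = c'.
  move=> ac ac'; apply/le_anti/andP; split.
    by apply: (Lle _ c) => // k; rewrite ac'.
  by apply: (Lge' _ c) => // k; rewrite ac'.
pose lim_ (z : nat -> N * M -> R) e := L (z^~ e).
have Lvsum z F : (forall k e, `|z k e| <= b e) ->
    vsum (lim_ z) F = L (fun k => vsum (z k) F).
  by move=> zb; rewrite /vsum Lsum // => e; exists (b e).
have Lvsumb z F : (forall k e, `|z k e| <= b e) ->
    forall k, `|vsum (z k) F| <= vsum b F.
  move=> zb k; apply: le_trans (ler_norm_sum _ _ _) _; exact: ler_sum.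
have xb k e : `|x k e| <= b e by apply: Ab; case: (Hx k).
have Alim : A (lim_ x).
  apply: admissible_clinchP => //.
  - by move=> e; apply: (Lge' _ (b e)) => // k; case: (Hx k) => -[].
  - move=> e ei; apply: (Lcst _ (b e)) => // k.
    by case: (Hx k) => -[_ /(_ e ei)].
  move=> u Pu.
  (* Each [x k] has its own witness for [u]. All witnesses obey the bound [b], and their
     coordinatewise limit is a witness for the limit of the [x k]. *)
  have /choice[y Hy] k : exists y, [/\ inPwd E g Nact w d y,
               forall e, e \in Eb E i -> y e = x k e &
               forall k, k \in Nact -> k != i -> vsum y (Eb E k) = u k].
    by case: (Hx k) => -[_ _ /(_ u)[_ /(_ Pu)]].
  have y0 k e : 0 <= y k e by case: (Hy k) => -[].
  have yb k e : `|y k e| <= b e.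
    by rewrite ger0_norm //; case: (Hy k) => /(inPwd_le1 _ wP).
  exists (lim_ y); split.
  - split.
    + by move=> e; apply: (Lge' _ (b e)).
    + move=> e eE; apply: (Lcst _ (b e)) => // k.
      by case: (Hy k) => -[_ /(_ e eE)].
    + split=> [e|e eE|j F Fj].
      * by rewrite addr_ge0 //; [case: wP|apply: (Lge' _ (b e))].
      * rewrite /lim_ (Lcst _ (b e) 0) => // [|k].
          by rewrite addr0; case: wP => _ /(_ e eE).
        by case: (Hy k) => -[_ /(_ e eE)].
      * rewrite vsumD Lvsum // -lerBrDl; apply: (Lle _ (vsum b F)).
          exact: Lvsumb.
        move=> k; rewrite lerBrDl -vsumD.
        by case: (Hy k) => -[_ _ [_ _ /(_ j F Fj)]].
    + move=> k kN; rewrite Lvsum //.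
      have yd h : demand_ok d k (vsum (y h) (Eb E k)).
        by case: (Hy h) => -[_ _ _ /(_ k kN)].
      move: yd; rewrite /demand_ok; case: (d k) => // dk yd.
      by apply: (Lle _ (vsum b (Eb E k))) => //; exact: Lvsumb.
  - move=> e ei; rewrite /lim_; congr L; apply/funext => k.
    by case: (Hy k) => _ /(_ e ei).
  - move=> k kN ki; rewrite Lvsum //; apply: (Lcst _ (vsum b (Eb E k))) => [|h].
      exact: Lvsumb.
    by case: (Hy h) => _ _ /(_ k kN ki).
exists (lim_ x); split=> // xi' Axi' xle.
have xi'S : vsum xi' (Eb E i) <= vsum (lim_ x) (Eb E i).
  apply: le_trans (ub_le_sup Sub _) _; first by exists xi'.
  rewrite Lvsum //; apply: (Lge _ (vsum b (Eb E i))); first exact: Lvsumb.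
  by move=> k; case: (Hx k).
apply/funext => e; have [ei|ei] := boolP (e \in Eb E i); last first.
  by case: Axi' Alim => [_ -> // _] [_ ->].
have : vsum (fun e => xi' e - lim_ x e) (Eb E i) == 0.
  rewrite eq_le vsum_ge0 /=; last by move=> e'; rewrite subr_ge0.
  by rewrite /vsum sumrB subr_le0 andbT.
rewrite psumr_eq0; last by move=> e' _; rewrite subr_ge0.
by move=> /allP/(_ e); rewrite mem_index_enum ei => /(_ isT); rewrite subr_eq0 => /eqP.
Qed.

(* A buyer [a] without demand bound whose only edge spans the whole market of
   [j] can absorb everything that [j] has left, so nobody else clinches from [j]. *)
Lemma clinch_uncontested w d a i j xi :
  inP' E g w -> nonneg_demands d ->
  Eb E a = [set (a, j)] -> a \in Nact -> d a = None ->
  (forall F, F \subset Es E j -> (a, j) \in F -> g j (Es E j) <= g j F) ->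
  admissible_clinch E g Nact w d i xi -> i != a -> xi (i, j) = 0.
Proof.
move=> wP d0 Ea aN da gj [xi0 xiE xiP] ia.
have [ijE|ijE] := boolP ((i, j) \in Eb E i); last exact: xiE.
have eE : (a, j) \in E by have := set11 (a, j); rewrite -Ea in_Eb => /andP[].
have ejE : (a, j) \in Es E j by rewrite in_Es eE eqxx.
(* [c] is what seller [j] has left, and [z] hands all of it to [a]. This is feasible because sets
   containing the edge of [a] have full rank and [a] has no demand bound. *)
pose c := g j (Es E j) - vsum w (Es E j).
have c0 : 0 <= c by rewrite subr_ge0; case: wP => _ _; exact.
pose z (e : N * M) := if e == (a, j) then c else 0.
have z0 e : 0 <= z e by rewrite /z; case: ifP.
have zF F : vsum z F = if (a, j) \in F then c else 0.
  rewrite /vsum /z -big_mkcondr /=; case: ifP => ajF.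
    rewrite (big_pred1 (a, j)) // => e /=.
    by have [->|] := eqVneq e (a, j); rewrite ?ajF ?andbF.
  by rewrite big_pred0 // => e; have [->|] := eqVneq e (a, j); rewrite ?ajF ?andbF.
have [w0 wE wg] := wP.
have zP : inPwd E g Nact w d z.
  split=> //.
  - by move=> e; rewrite /z; case: eqP => // ->; rewrite eE.
  - split=> [e|e eE'|j' F Fj].
    + by rewrite addr_ge0.
    + by rewrite wE // add0r /z; case: eqP eE' => // ->; rewrite eE.
    + rewrite vsumD zF; case: ifP => ajF; last by rewrite addr0 wg.
      have jj : j' = j.
        by move: (subsetP Fj _ ajF); rewrite in_Es => /andP[_ /= /eqP->].
      subst j'; apply: le_trans (gj F Fj ajF).
      by rewrite /c addrCA gerDl subr_le0 vsum_subset.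
  - move=> k kN; rewrite zF in_Eb eE /=.
    case: eqP => [<-|_]; last exact: d0.
    by rewrite /demand_ok da.
pose u k := vsum z (Eb E k).
have /xiP [y [[y0 yE [_ _ wyg] _] yxi yu]] : Pi E g Nact w d i (fun=> 0) u.
  exists z; split=> // e; rewrite in_Eb => /andP[_ /eqP ei].
  by rewrite /z; case: eqP => // ee; move: ia; rewrite -ei ee eqxx.
have ya : y (a, j) = c.
  have := yu a aN; rewrite eq_sym ia => /(_ isT).
  by rewrite /u Ea vsum_set1 zF set11.
have ijj : (i, j) \in Es E j.
  by move: ijE; rewrite in_Eb in_Es => /andP[-> _]; rewrite eqxx.
have aij : (a, j) != (i, j) by rewrite xpair_eqE negb_and eq_sym ia.
(* The witness [y] still gives [c] to [a], so [c + xi (i, j)] must fit into the residual [c]. *)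
have : vsum y [set (a, j); (i, j)] <= vsum y (Es E j).
  by apply: vsum_subset => //; rewrite subUset !sub1set ejE.
rewrite {1}/vsum big_setU1 ?inE //= big_set1 ya yxi // => cxi.
have := wyg j (Es E j) (subxx _); rewrite vsumD => /(le_trans (lerD (lexx _) cxi)).
rewrite /c addrA addrC [X in _ + X]addrC subrK gerDr => xi_le0.
by apply/le_anti; rewrite xi_le0 xi0.
Qed.
End Clinching.

Lemma onth_index (T : eqType) (s : seq T) x t : uniq s -> x \in s ->
  (onth s t == Some x) = (t == index x s).
Proof.
move=> s_uniq xs; rewrite onthE; have [ts|st] := ltnP t (size s).
  rewrite (nth_map x) // (inj_eq Some_inj) -[X in _ == X](nth_index x xs).
  by rewrite nth_uniq ?index_mem.
rewrite nth_default ?size_map //; apply/esym/eqP => ti.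
by move: st; rewrite ti leqNgt index_mem xs.
Qed.

(** Adding [h] to both sides of the congruence turns the turn of index [h] at time [t] into the
    divisibility at which a quotient by [d] increases by one. *)
Lemma dvdn_add_rev (d h t : nat) : (h < d)%N ->
  (d %| (t + (d.-1 - h)).+1)%N = (t %% d == h)%N.
Proof.
move=> hd; have d0 : (0 < d)%N by apply: leq_ltn_trans hd.
have -> : (t + (d.-1 - h)).+1 = (t + (d - h))%N.
  by rewrite -addnS -subSn ?prednK // -ltnS prednK.
have -> : (d %| t + (d - h))%N = (t + (d - h) == 0 %[mod d])%N by rewrite mod0n.
by rewrite -(eqn_modDr h) add0n -addnA subnK ?modnDr 1?ltnW // (modn_small hd).
Qed.

(** * Closed form of the clocks *)

Section Run.
Variables (R : realType) (N M : finType) (E : {set N * M}).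
Variable Nact : {set N}.
Variables (bid : N -> R) (B : N -> option R) (eps : R).
Variable chooser : (N * M -> R) -> (N -> option R) -> N -> (N * M -> R).

Definition pca_state t : state R N M :=
  iter t (pca_round E Nact bid B eps chooser) (pca_init R N M).

Lemma sc_clinch_all s : sc (clinch_all E Nact bid B chooser s) = sc s.
Proof. by rewrite /clinch_all; elim: (enum _) s => //= i l IH s; rewrite IH. Qed.

Lemma st_clinch_all s : st (clinch_all E Nact bid B chooser s) = st s.
Proof. by rewrite /clinch_all; elim: (enum _) s => //= i l IH s; rewrite IH. Qed.

Lemma sw_raise (s : state R N M) : sw (raise Nact bid B eps s) = sw s.
Proof. by rewrite /raise; case: cur_buyer. Qed.

Lemma sp_raise (s : state R N M) : sp (raise Nact bid B eps s) = sp s.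
Proof. by rewrite /raise; case: cur_buyer. Qed.

Lemma st_pca_state t : st (pca_state t) = t.
Proof.
elim: t => //= t IH; rewrite /pca_round /raise st_clinch_all IH.
by case: cur_buyer.
Qed.

(* The clock of the buyer of index [h] is raised at the times congruent to [h]
   modulo the number of buyers. *)
Lemma sc_pca_state t k : k \in Nact ->
  sc (pca_state t) k =
  ((t + (#|Nact|.-1 - index k (enum Nact))) %/ #|Nact|)%:R * eps.
Proof.
move=> kN.
have N0 : (0 < #|Nact|)%N by apply/card_gt0P; exists k.
have kidx : (index k (enum Nact) < #|Nact|)%N by rewrite cardE index_mem mem_enum.
elim: t => [|t IH].
  rewrite /= add0n divn_small ?mul0r //.
  by rewrite (leq_ltn_trans (leq_subr _ _)) // ltn_predL.
rewrite /= /pca_round /raise st_clinch_all -/(pca_state t) st_pca_state.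
have := @onth_index _ (enum Nact) k (t %% #|Nact|) (enum_uniq _).
rewrite mem_enum => /(_ kN); rewrite /cur_buyer.
have -> : (t.+1 + (#|Nact|.-1 - index k (enum Nact)) =
          (t + (#|Nact|.-1 - index k (enum Nact))).+1)%N by rewrite addSn.
rewrite divnS // dvdn_add_rev //.
case: onth => [l|] /= => [|<-]; last by rewrite sc_clinch_all IH.
rewrite sc_clinch_all eq_sym (inj_eq Some_inj) => <-.
have [_|_] /= := eqVneq k l; rewrite ?IH //.
by rewrite natrD mulrDl mul1r addrC.
Qed.
End Run.

(** * Invariants of the auction and what is clinched in a round *)

Section Invariant.
Variables (R : realType) (N M : finType) (E : {set N * M}).
Variable g : M -> {set N * M} -> R.
Variable Nact : {set N}.
Variables (bid : N -> R) (B : N -> option R) (eps : R).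
Variable chooser : (N * M -> R) -> (N -> option R) -> N -> (N * M -> R).
Hypothesis EN : forall e, e \in E -> e.1 \in Nact.
Hypothesis g_ge0 : forall j (F : {set N * M}), F \subset Es E j -> 0 <= g j F.
Hypothesis bid_gt0 : forall k, 0 < bid k.
Hypothesis B_ge0 : forall k b, B k = Some b -> 0 <= b.
Hypothesis eps_gt0 : 0 < eps.
Hypothesis chooserP : forall w d i, (exists xi, maximal_clinch E g Nact w d i xi) ->
  maximal_clinch E g Nact w d i (chooser w d i).

Local Notation run := (pca_state E Nact bid B eps chooser).

(** Feasibility and the nonnegative demands that follow from the other clauses are what
    [exists_maximal_clinch] requires. *)
Definition pca_inv (s : state R N M) : Prop :=
  [/\ inP' E g (sw s),
      forall k, sd s k = demand_of bid B (sp s) (sc s) k,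
      forall k, 0 <= sc s k &
      forall k b, B k = Some b -> sp s k <= b].

Lemma pca_inv_demands s : pca_inv s -> nonneg_demands Nact (sd s).
Proof.
move=> [_ sdE sc0 spB] k _; rewrite /demand_ok sdE /demand_of.
case: ifP => // _; case: ifP => // _; case: (B k) (spB k) => // b /(_ b erefl) pb.
by rewrite divr_ge0 // subr_ge0.
Qed.

(* The virtual buyer added for seller [j] is of this kind. *)
Definition dummy_buyer a j :=
  [/\ Eb E a = [set (a, j)], a \in Nact, B a = None &
  forall F : {set N * M}, F \subset Es E j -> (a, j) \in F -> g j (Es E j) <= g j F].

(** All prices are the clocks of [s], which clinching leaves fixed, so successive clinches add up.
    The clocks of [s'] do not occur, so the relation survives the raise that ends a round. *)
Definition clinched (s s' : state R N M) (q : N * M -> R) : Prop :=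
  [/\ forall e, 0 <= q e,
      forall e, sw s' e = sw s e + q e,
      forall k, sp s' k = sp s k + sc s k * vsum q (Eb E k),
      forall k, k \in Nact -> bid k <= sc s k -> vsum q (Eb E k) = 0 &
      forall a j i, dummy_buyer a j -> sc s a < bid a -> i != a ->
        q (i, j) = 0].

Lemma clinched_trans s1 s2 s3 q q' : sc s2 = sc s1 ->
  clinched s1 s2 q -> clinched s2 s3 q' -> clinched s1 s3 (fun e => q e + q' e).
Proof.
move=> c12 [q0 qw qp qb qu] [q'0 q'w q'p q'b q'u]; split.
- by move=> e; rewrite addr_ge0.
- by move=> e; rewrite q'w qw addrA.
- by move=> k; rewrite q'p qp c12 vsumD mulrDr addrA.
- by move=> k kN kb; rewrite vsumD qb ?q'b ?addr0 // c12.
- by move=> a j i aj ca ia; rewrite (qu a) ?(q'u a) ?addr0 // c12.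
Qed.

(** The chosen vector respects the demand of [i]. At a positive clock below the bid, with a finite
    budget, multiplying this demand by the clock gives the remaining budget; at clock zero nothing
    is paid; at a clock reaching the bid the demand is zero. *)
Lemma clinch_oneP s i : pca_inv s -> i \in Nact ->
  pca_inv (clinch_one E bid B chooser s i) /\
  exists q, clinched s (clinch_one E bid B chooser s i) q.
Proof.
move=> Is iN; have d0 := pca_inv_demands Is; have [wP sdE sc0 spB] := Is.
have [Axi _] := chooserP (exists_maximal_clinch i EN wP d0).
have [xi0 xiE _] := Axi.
have [_ _ wxiP xid] := admissible_clinch_inPwd EN wP d0 Axi.
rewrite /clinch_one; set xi := chooser (sw s) (sd s) i in Axi xi0 xiE wxiP xid *.
have xik k : k != i -> vsum xi (Eb E k) = 0.
  move=> ki; apply: vsum0 => e; rewrite in_Eb => /andP[_ /eqP ek].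
  by apply: xiE; rewrite in_Eb ek (negPf ki) andbF.
have xidE := xid _ iN; rewrite /demand_ok sdE /demand_of in xidE.
have xib : bid i <= sc s i -> vsum xi (Eb E i) = 0.
  move=> bc; move: xidE; rewrite gt_eqF ?(lt_le_trans (bid_gt0 i)) //.
  by rewrite ltNge bc /= => xi_le0; apply/le_anti; rewrite xi_le0 vsum_ge0.
split.
- split=> //= k b Bk; case: eqP => [ki|_]; last exact: spB.
  move: xidE; rewrite -ki in xib *; have [->|ck] := eqVneq (sc s k) 0.
    by rewrite mul0r addr0 => _; exact: spB.
  have {}ck : 0 < sc s k by rewrite lt_neqAle eq_sym ck sc0.
  case: ltP => [_|/xib -> _]; last by rewrite mulr0 addr0; exact: spB.
  by rewrite Bk ler_pdivlMr // mulrC lerBrDl.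
- exists xi; split=> //=.
  + move=> k; case: eqP => [->//|/eqP ki].
    by rewrite xik // mulr0 addr0.
  + by move=> k kN; have [->|ki] := eqVneq k i; [exact: xib|rewrite xik].
  + move=> a j k [Ea aN Ba gj] ca ka.
    have [ki|ki] := eqVneq k i; last by rewrite xiE // in_Eb /= (negPf ki) andbF.
    subst k; apply: (clinch_uncontested wP d0 Ea aN _ gj Axi) => //.
    by rewrite sdE /demand_of ca Ba if_same.
Qed.

Lemma clinch_allP s : pca_inv s ->
  pca_inv (clinch_all E Nact bid B chooser s) /\
  exists q, clinched s (clinch_all E Nact bid B chooser s) q.
Proof.
rewrite /clinch_all; have : {subset enum Nact <= Nact} by move=> k; rewrite mem_enum.
elim: (enum Nact) s => [|i l IH] s lN Is /=.
  split=> //; exists (fun=> 0); split=> // *; rewrite ?vsum0 ?mulr0 ?addr0 //.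
have iN : i \in Nact by apply: lN; rewrite mem_head.
have [I1 [q1 H1]] := clinch_oneP Is iN.
have [|I2 [q2 H2]] := IH _ _ I1; first by move=> k kl; apply: lN; rewrite inE kl orbT.
by split=> //; exists (fun e => q1 e + q2 e); apply: clinched_trans H2.
Qed.

Lemma pca_inv_init : pca_inv (pca_init R N M).
Proof.
split=> //=; first by split=> // j F Fj; rewrite vsum0 // g_ge0.
by move=> k; rewrite /demand_of eqxx.
Qed.

Lemma pca_inv_raise s : pca_inv s -> pca_inv (raise Nact bid B eps s).
Proof.
move=> [wP sdE sc0 spB]; rewrite /raise; case: cur_buyer => // l.
split=> //= k; case: eqP => kl //; rewrite ?addr_ge0 // 1?ltW //.
(* Demands of the other buyers are not refreshed, but their clocks and payments have not changed. *)
by rewrite sdE /demand_of; have /eqP/negPf -> := kl.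
Qed.

Lemma pca_inv_state t : pca_inv (run t).
Proof.
elim: t => [|t IH]; first exact: pca_inv_init.
by apply: pca_inv_raise; case: (clinch_allP IH).
Qed.

Lemma pca_round_clinched t : exists q, clinched (run t) (run t.+1) q.
Proof.
have [_ [q [q0 qw qp qb qu]]] := clinch_allP (pca_inv_state t).
by exists q; split=> //= *; rewrite /pca_round ?sw_raise ?sp_raise ?qw ?qp.
Qed.

End Invariant.

(** * Termination and the evolution of a buyer's utility *)

Section Utility.
Variables (R : realType) (N M : finType) (E : {set N * M}).
Variable g : M -> {set N * M} -> R.
Variable Nact : {set N}.
Variables (B : N -> option R) (eps : R).
Variable chooser : (N * M -> R) -> (N -> option R) -> N -> (N * M -> R).
Hypothesis EN : forall e, e \in E -> e.1 \in Nact.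
Hypothesis g_ge0 : forall j (F : {set N * M}), F \subset Es E j -> 0 <= g j F.
Hypothesis B_ge0 : forall k b, B k = Some b -> 0 <= b.
Hypothesis eps_gt0 : 0 < eps.
Hypothesis chooserP : forall w d i, (exists xi, maximal_clinch E g Nact w d i xi) ->
  maximal_clinch E g Nact w d i (chooser w d i).
Implicit Types bid : N -> R.

Local Notation run bid := (pca_state E Nact bid B eps chooser).
Local Notation final bid := (pca_final E Nact bid B eps chooser).

Lemma sc_pca_state_indep bid bid' t k : k \in Nact ->
  sc (run bid t) k = sc (run bid' t) k.
Proof. by move=> kN; rewrite !sc_pca_state. Qed.

Lemma sc_pca_state_mono bid t t' k : k \in Nact -> (t <= t')%N ->
  sc (run bid t) k <= sc (run bid t') k.
Proof.
move=> kN tt'; rewrite !sc_pca_state // ler_pM2r // ler_nat.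
by rewrite leq_div2r // leq_add2r.
Qed.

Lemma pca_final_unique bid s s' : final bid s -> final bid s' -> s = s'.
Proof.
move=> [t [tmin th ->]] [t' [t'min t'h ->]].
by case: (ltngtP t t') => [/t'min|/tmin|->].
Qed.

Lemma pca_final_exists bid : (forall k, 0 < bid k) -> exists s, final bid s.
Proof.
move=> bid0.
pose haltb t := [forall k in Nact, sd (run bid t) k == Some 0].
have haltP t : reflect (halted Nact (run bid t)) (haltb t).
  apply: (iffP forall_inP) => h k kN; first exact/eqP/h.
  by rewrite h.
have ex : exists t, haltb t.
  (* [Q * eps] exceeds the sum of all bids, so after [Q] full cycles every active clock has passed
     its bid and every demand is zero. *)
  pose b := \sum_k bid k; pose Q := Num.bound (b / eps).
  exists (Q * #|Nact|)%N; apply/haltP => k kN.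
  have N0 : (0 < #|Nact|)%N by apply/card_gt0P; exists k.
  have [_ -> _ _] := pca_inv_state EN g_ge0 bid0 B_ge0 eps_gt0 chooserP (Q * #|Nact|).
  have bk : bid k <= sc (run bid (Q * #|Nact|)) k.
    have kb : bid k <= b.
      by rewrite /b (bigD1 k) //= lerDl sumr_ge0 // => i _; exact: ltW.
    have b0 : 0 <= b by apply: le_trans kb; exact: ltW.
    apply: (le_trans kb); rewrite sc_pca_state // divnMDl // natrD mulrDl.
    rewrite -[leLHS]addr0 lerD //; last by rewrite mulr_ge0 // ltW.
    by rewrite -ler_pdivrMr // ltW // archi_boundP // divr_ge0 // ltW.
  by rewrite /demand_of gt_eqF ?(lt_le_trans (bid0 k)) // ltNge bk.
case: (ex_minnP ex) => t /haltP th tmin; exists (run bid t), t; split=> //.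
by move=> t' t't /haltP/tmin; rewrite leqNgt t't.
Qed.

Lemma pca_buyer_step bid t k : (forall i, 0 < bid i) -> k \in Nact ->
  exists q, [/\ 0 <= q,
    vsum (sw (run bid t.+1)) (Eb E k) = vsum (sw (run bid t)) (Eb E k) + q,
    sp (run bid t.+1) k = sp (run bid t) k + sc (run bid t) k * q &
    bid k <= sc (run bid t) k -> q = 0].
Proof.
move=> bid0 kN.
have [q [q0 qw qp qb _]] := pca_round_clinched EN g_ge0 bid0 B_ge0 eps_gt0 chooserP t.
exists (vsum q (Eb E k)); split=> //; [exact: vsum_ge0| |exact: qb].
by rewrite -vsumD; apply: eq_vsum => e _; exact: qw.
Qed.

(** The valuation [v] is separate from the bid, so that a run with a false bid can be measured by
    the true valuation. *)
Definition pca_utility bid k v t : R :=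
  v * vsum (sw (run bid t)) (Eb E k) - sp (run bid t) k.

Lemma pca_utility_step bid t k v : (forall i, 0 < bid i) -> k \in Nact ->
  exists q, [/\ 0 <= q,
    pca_utility bid k v t.+1 =
      pca_utility bid k v t + (v - sc (run bid t) k) * q &
    bid k <= sc (run bid t) k -> q = 0].
Proof.
move=> bid0 kN; have [q [q0 qw qp qb]] := pca_buyer_step t bid0 kN.
exists q; split=> //; rewrite /pca_utility qw qp mulrDr mulrBl opprD.
by rewrite -!addrA; congr (_ + _); rewrite addrCA.
Qed.

(** A truthful buyer clinches only at clocks below her valuation, so each round adds a nonnegative
    gain. *)
Lemma pca_utility_mono bid t t' k : (forall i, 0 < bid i) -> k \in Nact ->
  (t <= t')%N -> pca_utility bid k (bid k) t <= pca_utility bid k (bid k) t'.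
Proof.
move=> bid0 kN /subnK <-; elim: (t' - t)%N => // h IH; apply: le_trans IH _.
have [q [q0 -> qb]] := pca_utility_step (h + t) (bid k) bid0 kN.
rewrite lerDl; case: (lerP (bid k) (sc (run bid (h + t)) k)) => [/qb ->|ck].
  by rewrite mulr0.
by rewrite mulr_ge0 // subr_ge0 ltW.
Qed.

Lemma pca_utility_ge0 bid t k : (forall i, 0 < bid i) -> k \in Nact ->
  0 <= pca_utility bid k (bid k) t.
Proof.
move=> bid0 kN; apply: le_trans (pca_utility_mono bid0 kN (leq0n t)).
by rewrite /pca_utility /= vsum0 // mulr0 subr0.
Qed.

Lemma pca_budget bid t k b : (forall i, 0 < bid i) -> B k = Some b ->
  sp (run bid t) k <= b.
Proof.
move=> bid0; have [_ _ _] := pca_inv_state EN g_ge0 bid0 B_ge0 eps_gt0 chooserP t.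
exact.
Qed.

(** * Two runs that differ in the bid of one buyer *)

Section Deviation.
Variables (bid1 bid2 : N -> R) (i : N).
Hypothesis eq_bid : forall k, k != i -> bid1 k = bid2 k.
Hypothesis iN : i \in Nact.

Lemma demand_of_indep p (c : N -> R) : c i < bid1 i -> c i < bid2 i ->
  demand_of bid1 B p c =1 demand_of bid2 B p c.
Proof.
move=> c1 c2 k; rewrite /demand_of; have [->|ki] := eqVneq k i; last by rewrite eq_bid.
by rewrite c1 c2.
Qed.

Lemma clinch_all_indep (s : state R N M) : sc s i < bid1 i -> sc s i < bid2 i ->
  clinch_all E Nact bid1 B chooser s = clinch_all E Nact bid2 B chooser s.
Proof.
rewrite /clinch_all; elim: (enum Nact) s => //= k l IH s c1 c2.
rewrite IH //; congr foldl; rewrite /clinch_one; congr St.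
by apply/funext; exact: demand_of_indep.
Qed.

Lemma pca_state_indep t : sc (run bid1 t) i < bid1 i -> sc (run bid1 t) i < bid2 i ->
  run bid1 t = run bid2 t.
Proof.
elim: t => // t IH c1 c2.
have tS := @sc_pca_state_mono bid1 t t.+1 i iN (leqnSn t).
have ct1 := le_lt_trans tS c1; have ct2 := le_lt_trans tS c2.
have e := IH ct1 ct2.
move: c1 c2; rewrite /= /pca_round -/(run bid1 t) -/(run bid2 t) -e.
rewrite -clinch_all_indep //.
rewrite /raise; case: cur_buyer => //= l c1 c2; congr St.
by apply/funext => k; rewrite demand_of_indep.
Qed.

(** A round clinches before it raises. Allocation and payments therefore agree for one more round,
    even if its raise brings the clock up to a bid and the demands start to differ. *)
Lemma sw_sp_indep t : sc (run bid1 t) i < bid1 i -> sc (run bid1 t) i < bid2 i ->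
  sw (run bid1 t.+1) = sw (run bid2 t.+1) /\ sp (run bid1 t.+1) = sp (run bid2 t.+1).
Proof.
move=> c1 c2; rewrite /= /pca_round -/(run bid1 t) -/(run bid2 t) -pca_state_indep //.
by rewrite -clinch_all_indep // !sw_raise !sp_raise.
Qed.

(* The two runs coincide until the clock of [i] reaches the smaller of the two
   bids.  From then on the truthful run only gains utility, whereas the other
   one either clinches nothing more or pays at least the valuation. *)
Lemma pca_truthful s1 s2 : (forall k, 0 < bid1 k) -> (forall k, 0 < bid2 k) ->
  final bid1 s1 -> final bid2 s2 ->
  bid1 i * vsum (sw s2) (Eb E i) - sp s2 i <= bid1 i * vsum (sw s1) (Eb E i) - sp s1 i.
Proof.
move=> bid1_gt0 bid2_gt0 [K1 [min1 h1 ->]] [K2 [min2 h2 ->]].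
rewrite -!/(pca_state _ _ _ _ _ _ _) in min1 h1 min2 h2 *.
rewrite -/(pca_utility bid1 i (bid1 i) K1) -/(pca_utility bid2 i (bid1 i) K2).
pose c t := sc (run bid1 t) i; pose b := Num.min (bid1 i) (bid2 i).
have c_mono t t' : (t <= t')%N -> c t <= c t' by exact: sc_pca_state_mono.
have [cb|bc] := ltP (c (minn K1 K2)) b.
  have /andP[cb1 cb2] : (c (minn K1 K2) < bid1 i) && (c (minn K1 K2) < bid2 i).
    by rewrite -lt_min.
  have e := pca_state_indep cb1 cb2.
  (* The states coincide at the earlier stopping time, so the other run halts there too. *)
  have K12 : K1 = K2.
    case: (ltngtP K1 K2) e => // [K12|K21] e.
      by case: (min2 _ K12); rewrite -/(run bid2 K1) -e.
    by case: (min1 _ K21); rewrite -/(run bid1 K2) e.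
  by move: e; rewrite -K12 minnn /pca_utility => ->.
have ex : exists t, b <= c t by exists (minn K1 K2).
(* [T.+1] is the first time the clock reaches the smaller bid; time zero is excluded because clocks
   start at zero and bids are positive. *)
case: (ex_minnP ex) => -[|T] bT Tmin.
  by move: bT; rewrite leNgt lt_min bid1_gt0 bid2_gt0.
have /andP[cb1 cb2] : (c T < bid1 i) && (c T < bid2 i).
  by rewrite -lt_min ltNge; apply/negP => /Tmin; rewrite ltnn.
have [swe spe] := sw_sp_indep cb1 cb2.
have UT : pca_utility bid1 i (bid1 i) T.+1 = pca_utility bid2 i (bid1 i) T.+1.
  by rewrite /pca_utility swe spe.
have TK := Tmin _ bc; rewrite leq_min in TK; have /andP[TK1 TK2] := TK.
apply: le_trans (pca_utility_mono bid1_gt0 iN TK1); rewrite UT.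
rewrite -(subnK TK2); elim: (K2 - T.+1)%N => // h IH; apply: le_trans IH; rewrite addSn.
have [q [q0 -> qb]] := pca_utility_step (h + T.+1) (bid1 i) bid2_gt0 iN.
rewrite gerDl; have := le_trans bT (c_mono _ _ (leq_addl h T.+1)).
rewrite /c (sc_pca_state_indep _ bid2) // ge_min => /orP[c1|/qb->].
  by rewrite mulr_le0_ge0 // subr_le0.
by rewrite mulr0.
Qed.
End Deviation.
End Utility.

(** The enumeration of a sum type lists the left summand first, which puts real buyers before
    virtual ones in the cycle. *)
Lemma index_inl_inr (S T : finType) (A : {set S + T}) x y : inl x \in A ->
  (index (inl x : S + T) (enum A) <= index (inr y : S + T) (enum A))%N.
Proof.
move=> xA; rewrite [enum_mem _]/enum_mem.
have -> : Finite.enum (S + T)%type =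
    [seq inl x | x <- enum S] ++ [seq inr y | y <- enum T].
  by rewrite !enumT [in LHS]unlock.
rewrite filter_cat !index_cat.
have -> : (inl x : S + T) \in filter (mem A) [seq inl x | x <- enum S].
  by rewrite mem_filter /= xA map_f // mem_enum.
rewrite ifN; first exact: leq_trans (index_size _ _) (leq_addr _ _).
by rewrite mem_filter negb_and; apply/orP; right; apply/mapP => -[].
Qed.

(** * The mechanism on the market augmented by virtual buyers *)

Section Mechanism.
Variables (R : realType) (n m : nat) (E : {set 'I_n * 'I_m}).
Variables (f : 'I_m -> {set 'I_n * 'I_m} -> R) (eps : R) (ch : chooser_t R n m).
Hypothesis f_rank : forall j, polymatroid_rank E f j.
Hypothesis eps_gt0 : 0 < eps.
Hypothesis chP : chooser_spec ch.

Lemma eps_mult_gt0 (x : R) : eps_mult eps x -> 0 < x.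
Proof. by case=> k ->; rewrite mulr_gt0 // ltr0n. Qed.

Section Inputs.
Variables (B : 'I_n -> R) (rho' rhos : 'I_m -> R).
Hypothesis B_ge0 : forall i, 0 <= B i.
Hypothesis rhos_gt0 : forall j, 0 < rhos j.
Implicit Types v : 'I_n -> R.

Local Notation Ea := (Eaug E rho' rhos).
Local Notation Na := (Naug n rho' rhos).
Local Notation ga := (gaug E f).
Local Notation Ba := (@Baug R n m B).
Local Notation bida v := (bidaug v rhos).
Local Notation run v := (pca_state Ea Na (bida v) Ba eps (ch Ea Na ga)).
Local Notation final v := (pca_final Ea Na (bida v) Ba eps (ch Ea Na ga)).

Lemma in_Etil e :
  (e \in Etil E rho' rhos) = (e \in E) && (e.2 \in Mtil rho' rhos).
Proof. by rewrite inE. Qed.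

Lemma Eaug_Naug e : e \in Ea -> e.1 \in Na.
Proof. by rewrite !inE; case: e.1 => // j /andP[]. Qed.

Lemma gaug_ge0 j (F : {set AB n m * 'I_m}) : F \subset Es Ea j -> 0 <= ga j F.
Proof.
have [_ f0 _ _] := f_rank j; move=> Fj; rewrite /gaug; case: ifP => _; first exact: f0.
apply: f0; apply/subsetP => -[i k]; rewrite inE => /(subsetP Fj).
by rewrite in_Es !inE /= in_Etil => /andP[/andP[/= -> _] ->].
Qed.

Lemma Baug_ge0 k b : Ba k = Some b -> 0 <= b.
Proof. by case: k => //= i [<-]. Qed.

Lemma bidaug_gt0 v k : (forall i, 0 < v i) -> 0 < bida v k.
Proof. by case: k => /=. Qed.

Lemma chooser_maximal w d i : (exists xi, maximal_clinch Ea ga Na w d i xi) ->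
  maximal_clinch Ea ga Na w d i (ch Ea Na ga w d i).
Proof. exact: chP. Qed.

Lemma inl_Naug i : inl i \in Na.
Proof. by rewrite inE. Qed.

Lemma sum_Eb_inl (y : AB n m * 'I_m -> R) i :
  \sum_(e in Eb Ea (inl i)) y e =
  \sum_(e in Etil E rho' rhos | e.1 == i) y (inl e.1, e.2).
Proof.
pose h (e : 'I_n * 'I_m) : AB n m * 'I_m := (inl e.1, e.2).
pose h' (e : AB n m * 'I_m) := (if e.1 is inl k then k else i, e.2).
rewrite (reindex_onto h h') /=; last first.
  by case=> a j; rewrite in_Eb => /andP[_ /= /eqP->].
apply: eq_bigl => -[k j]; rewrite in_Eb /h /h' /= eqxx andbT.
by rewrite inE /= (inj_eq inl_inj).
Qed.

Lemma Mtil_dummy_buyer j : j \in Mtil rho' rhos ->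
  dummy_buyer Ea ga Na Ba (inr j) j.
Proof.
move=> jM; split=> //; [|by rewrite inE|].
- apply/setP => -[a k]; rewrite in_Eb !inE /= xpair_eqE andbC.
  have [->|//] := eqVneq a (inr j); rewrite jM andbT /=.
  by rewrite eq_sym.
- move=> F Fj jF; rewrite /gaug jF ifT // in_Es inE /= eqxx andbT.
  by move: jM; rewrite inE => ->.
Qed.

(** Induction on rounds: each newly clinched unit from [j] is paid at a clock of at least
    [rhos j]. *)
Lemma pca_reserve_price v t i : (forall k, 0 < v k) ->
  \sum_(e in Eb Ea (inl i)) rhos e.2 * sw (run v t) e <= sp (run v t) (inl i).
Proof.
move=> v0; have bid0 k : 0 < bida v k by exact: bidaug_gt0.
elim: t => [|t IH]; first by rewrite big1 // => e _; rewrite mulr0.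
have [q [q0 qw qp qb qu]] :=
  pca_round_clinched Eaug_Naug gaug_ge0 bid0 Baug_ge0 eps_gt0 chooser_maximal t.
rewrite qp; under eq_bigr do rewrite qw mulrDr.
rewrite big_split lerD //= /vsum mulr_sumr; apply: ler_sum => -[a j] /=.
rewrite in_Eb => /andP[eE /= /eqP ai]; rewrite {}ai in eE *.
have jM : j \in Mtil rho' rhos by move: eE; rewrite inE /= in_Etil => /andP[].
have [cj|cj] := ltP (sc (run v t) (inr j)) (rhos j).
  by rewrite (qu _ _ (inl i) (Mtil_dummy_buyer jM)) ?mulr0.
rewrite ler_wpM2r //; apply: le_trans cj _.
have [_ jN _ _] := Mtil_dummy_buyer jM.
(* In the closed form of the clocks, a smaller index means a clock that is at least as large. *)
rewrite !sc_pca_state ?inl_Naug // ler_pM2r // ler_nat leq_div2r // leq_add2l.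
by rewrite leq_sub2l // index_inl_inr // inl_Naug.
Qed.

Definition mech_outcome (s : state R (AB n m) 'I_m) : outcome R n m :=
  Outcome (fun e => if e \in Etil E rho' rhos then sw s (inl e.1, e.2) else 0)
    (fun i => sp s (inl i))
    (fun j => if j \in Mtil rho' rhos then
       rhos j * \sum_(e in Etil E rho' rhos | e.2 == j) sw s (inl e.1, e.2) else 0).

Lemma xbuyer_outcome s i : xbuyer E (mech_outcome s) i = vsum (sw s) (Eb Ea (inl i)).
Proof.
rewrite /vsum sum_Eb_inl /xbuyer /= -big_mkcondr /=; apply: eq_bigl => e.
by rewrite !inE; case: (e \in E) => //=; rewrite andbC.
Qed.

(** The utility is the margin per unit times the amount sold, and an excluded seller sells
    nothing. *)
Lemma useller_outcome s rho j : useller E f rho (mech_outcome s) j =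
  if j \in Mtil rho' rhos then
    (rhos j - rho) * \sum_(e in Etil E rho' rhos | e.2 == j) sw s (inl e.1, e.2)
  else 0.
Proof.
rewrite /useller /xseller subKr /= -big_mkcondr /=.
case: ifP => jM.
  rewrite mulrBl; congr (_ - _ * _); apply: eq_bigl => e.
  by rewrite in_Etil !inE; case: (e \in E) => //=; rewrite andbC.
rewrite big_pred0 ?mulr0 ?subr0 // => e.
rewrite in_Etil !inE; case: eqP => [->|]; rewrite ?andbF //.
by move: jM; rewrite inE => ->; rewrite !andbF.
Qed.

Lemma sw_sum_ge0 v s j : (forall i, 0 < v i) -> final v s ->
  0 <= \sum_(e in Etil E rho' rhos | e.2 == j) sw s (inl e.1, e.2).
Proof.
move=> v0 [t [_ _ ->]]; have bid0 k : 0 < bida v k by exact: bidaug_gt0.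
have [[w0 _ _] _ _ _] :=
  pca_inv_state Eaug_Naug gaug_ge0 bid0 Baug_ge0 eps_gt0 chooser_maximal t.
by apply: sumr_ge0 => e _; exact: w0.
Qed.

Lemma op_outcome_le v s i : (forall i, 0 < v i) -> final v s ->
  op (mech_outcome s) i <= B i.
Proof.
move=> v0 [t [_ _ ->]]; have bid0 k : 0 < bida v k by exact: bidaug_gt0.
exact: (pca_budget Eaug_Naug gaug_ge0 Baug_ge0 eps_gt0 chooser_maximal t bid0).
Qed.

Lemma mech_final_exists v : (forall i, 0 < v i) -> exists s, final v s.
Proof.
move=> v0; have bid0 k : 0 < bida v k by exact: bidaug_gt0.
exact: (pca_final_exists Eaug_Naug gaug_ge0 Baug_ge0 eps_gt0 chooser_maximal bid0).
Qed.

Lemma ubuyer_outcome_ge0 v s i : (forall i, 0 < v i) -> final v s ->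
  (0 <= ubuyer E (v i) (B i) (mech_outcome s) i)%E.
Proof.
move=> v0 fs; rewrite /ubuyer (op_outcome_le _ v0 fs) lee_fin xbuyer_outcome.
have bid0 k : 0 < bida v k by exact: bidaug_gt0.
case: fs => t [_ _ ->].
exact: (pca_utility_ge0 Eaug_Naug gaug_ge0 Baug_ge0 eps_gt0 chooser_maximal t
  bid0 (inl_Naug i)).
Qed.

Lemma ubuyer_truthful v i vi s1 s2 : (forall i, 0 < v i) -> 0 < vi ->
  final (upd v i vi) s1 -> final v s2 ->
  (ubuyer E vi (B i) (mech_outcome s2) i <= ubuyer E vi (B i) (mech_outcome s1) i)%E.
Proof.
move=> v0 vi0 f1 f2.
have u0 k : 0 < upd v i vi k by rewrite /upd; case: ifP.
rewrite /ubuyer (op_outcome_le _ u0 f1); case: ifP => _; last exact: leNye.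
have bid1 k : 0 < bida (upd v i vi) k by exact: bidaug_gt0.
have bid2 k : 0 < bida v k by exact: bidaug_gt0.
have eqb k : k != inl i -> bida (upd v i vi) k = bida v k.
  by case: k => //= k; rewrite (inj_eq inl_inj) /upd => /negPf ->.
have := pca_truthful Eaug_Naug gaug_ge0 Baug_ge0 eps_gt0 chooser_maximal eqb
  (inl_Naug i) bid1 bid2 f1 f2.
by rewrite /= /upd eqxx lee_fin !xbuyer_outcome.
Qed.

(** Summing the reserve price bound over buyers gives the sampled value of all units sold; regrouped
    by seller, this is the total revenue. *)
Lemma mech_weakly_balanced v s : (forall i, 0 < v i) -> final v s ->
  \sum_j or (mech_outcome s) j <= \sum_i op (mech_outcome s) i.
Proof.
move=> v0 [t [_ _ ->]]; set s' := iter _ _ _.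
apply: (@le_trans _ _ (\sum_i \sum_(e in Eb Ea (inl i)) rhos e.2 * sw s' e));
  last first.
  by apply: ler_sum => i _; exact: pca_reserve_price.
under [leRHS]eq_bigr do rewrite sum_Eb_inl /=.
rewrite /= -big_mkcond /=; under eq_bigr do rewrite mulr_sumr.
rewrite -(partition_big (fun e : 'I_n * 'I_m => e.1) xpredT) //=.
rewrite (partition_big (fun e : 'I_n * 'I_m => e.2) (mem (Mtil rho' rhos))) /=.
  by apply: ler_sum => j _; apply: ler_sum => e /andP[_ /eqP->].
by move=> e; rewrite in_Etil => /andP[].
Qed.
End Inputs.

Lemma useller_truthful v B rho' rhos j rhoj s1 s2 :
  (forall i, 0 < v i) -> (forall i, 0 <= B i) -> (forall j, 0 < rhos j) ->
  let final rho := pca_final (Eaug E rho rhos) (Naug n rho rhos) (bidaug v rhos)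
    (@Baug R n m B) eps (ch (Eaug E rho rhos) (Naug n rho rhos) (gaug E f)) in
  final (upd rho' j rhoj) s1 -> final rho' s2 ->
  useller E f rhoj (mech_outcome rho' rhos s2) j <=
  useller E f rhoj (mech_outcome (upd rho' j rhoj) rhos s1) j.
Proof.
move=> v0 B0 r0 final f1 f2; rewrite !useller_outcome.
have S1 := sw_sum_ge0 B0 r0 j v0 f1; have S2 := sw_sum_ge0 B0 r0 j v0 f2.
have jM1 : (j \in Mtil (upd rho' j rhoj) rhos) = (rhoj <= rhos j).
  by rewrite inE /upd eqxx.
have [rj|rj] := leP rhoj (rhos j); rewrite jM1; last first.
  rewrite (lt_geF rj); case: ifP => // _.
  by rewrite mulr_le0_ge0 // subr_le0 ltW.
rewrite rj; case: ifP => jM2; last by rewrite mulr_ge0 // subr_ge0.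
(* Seller bids enter the auction only through the set of participants. If [j] participates under
   both bids, the two auctions are identical and so are their final states. *)
have eM : Mtil (upd rho' j rhoj) rhos = Mtil rho' rhos.
  apply/setP => k; have [->|kj] := eqVneq k j; first by rewrite jM1 jM2 rj.
  by rewrite !inE /upd (negPf kj).
move: f1 S1; rewrite /final /Eaug /Etil /Naug eM => f1 _.
by rewrite (pca_final_unique f1 f2).
Qed.
End Mechanism.

Theorem theorem4p3 (R : realType) (n m : nat) (E : {set 'I_n * 'I_m})
    (f : 'I_m -> {set 'I_n * 'I_m} -> R) (eps : R) (ch : chooser_t R n m) :
  (forall j, polymatroid_rank E f j) -> 0 < eps -> chooser_spec ch ->
  let Mout := M_outcome E f eps ch in
  (* the mechanism is well defined (the PCA loop terminates) *)
  (forall v' B rho' rhos, valid_inputs eps v' B rho' rhos ->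
     exists o, Mout v' B rho' rhos o) /\
  (* DSIC for buyers *)
  (forall v' B rho' rhos (i : 'I_n) (vi : R) (o1 o2 : outcome R n m),
     valid_inputs eps v' B rho' rhos -> eps_mult eps vi ->
     Mout (upd v' i vi) B rho' rhos o1 -> Mout v' B rho' rhos o2 ->
     (ubuyer E vi (B i) o2 i <= ubuyer E vi (B i) o1 i)%E) /\
  (* DSIC for sellers *)
  (forall v' B rho' rhos (j : 'I_m) (rhoj : R) (o1 o2 : outcome R n m),
     valid_inputs eps v' B rho' rhos -> 0 < rhoj ->
     Mout v' B (upd rho' j rhoj) rhos o1 -> Mout v' B rho' rhos o2 ->
     useller E f rhoj o2 j <= useller E f rhoj o1 j) /\
  (* IR for buyers and sellers *)
  (forall v' B rho' rhos (o : outcome R n m),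
     valid_inputs eps v' B rho' rhos -> Mout v' B rho' rhos o ->
     (forall i, (0 <= ubuyer E (v' i) (B i) o i)%E) /\
     (forall j, 0 <= useller E f (rho' j) o j)) /\
  (* WBB *)
  (forall v' B rho' rhos (o : outcome R n m),
     valid_inputs eps v' B rho' rhos -> Mout v' B rho' rhos o ->
     \sum_(j < m) or o j <= \sum_(i < n) op o i).
Proof.
move=> f_rank eps0 chP Mout.
have valid v' B rho' rhos : valid_inputs eps v' B rho' rhos ->
    [/\ forall i, 0 < v' i, forall i, 0 <= B i & forall j, 0 < rhos j].
  by case=> v0 B0 _ r0; split=> // k; exact/(eps_mult_gt0 eps0).
split; [|split; [|split; [|split]]].
- move=> v' B rho' rhos /valid[v0 B0 r0].
  have [s fs] := mech_final_exists f_rank eps0 chP rho' B0 r0 v0.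
  by exists (mech_outcome E rho' rhos s), s.
- move=> v' B rho' rhos i vi o1 o2 /valid[v0 B0 r0] /(eps_mult_gt0 eps0) vi0.
  move=> [s1 [f1 ->]] [s2 [f2 ->]].
  exact: (ubuyer_truthful f_rank eps0 chP B0 r0 v0 vi0 f1 f2).
- move=> v' B rho' rhos j rhoj o1 o2 /valid[v0 B0 r0] _ [s1 [f1 ->]] [s2 [f2 ->]].
  exact: (useller_truthful f_rank eps0 chP v0 B0 r0 f1 f2).
- move=> v' B rho' rhos o /valid[v0 B0 r0] [s [fs ->]]; split=> [i|j].
    exact: (ubuyer_outcome_ge0 f_rank eps0 chP B0 r0 i v0 fs).
  (* A participating seller has [rho' j <= rhos j], hence a nonnegative margin. *)
  rewrite [leRHS](useller_outcome E f rho' rhos s); case: ifP => // jM.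
  rewrite mulr_ge0 //; first by move: jM; rewrite inE subr_ge0.
  exact: (sw_sum_ge0 f_rank eps0 chP B0 r0 j v0 fs).
- move=> v' B rho' rhos o /valid[v0 B0 r0] [s [fs ->]].
  exact: (mech_weakly_balanced f_rank eps0 chP B0 r0 v0 fs).
Qed.
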